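(* Let $(E,d)$ be a Polish (metric) space, $\alpha\in(0,1/2)$, $T>0$, and let $\mathbf X$ be an $E$-valued stochastic process on $[0,T]$ with continuous sample paths, adapted to a filtration $(\mathcal F_t)_{t\in[0,T]}$. Assume: (1) There exists $C_1>0$ such that for every $c,\varepsilon>0$ and every H\''older stopping time $\tau$ of $\mathbf X$, a.s. $$\mathbb P\Big[\sup_{t\in[\tau,\tau+\varepsilon]}d(\mathbf X_\tau,\mathbf X_t)>c\ \Big|\ \mathcal F_\tau\Big]\le C_1\exp\Big(\frac{-c^2}{C_1\varepsilon}\Big).$$ (2) There exist $c_2,C_2>0$ and $x\in E$ such that for every $s\in[0,T]$ and $\varepsilon\in(0,T-s]$, a.s. $$\mathbb P\big[\mathbf X_{s+\varepsilon}\in B(x,C_2\varepsilon^{1/2})\ \big|\ \mathcal F_s\big]\ge c_2\,\mathbf 1\{\mathbf X_s\in B(x,C_2\varepsilon^{1/2})\}.$$ Fix $x$ as in (2). Then there exist $C,c>0$, depending only on $C_1,c_2,C_2,\alpha,T$, such that for every $\gamma>0$, a.s. $$\mathbb P\big[\|\mathbf X\|_{\alpha\text{-H\''ol};[0,T]}<\gamma\ \big|\ \mathcal F_0\big]\ge C^{-1}\exp\Big(\frac{-C}{\gamma^{2/(1-2\alpha)}}\Big)\mathbf 1\{\mathbf X_0\in B(x,c\,\gamma^{1/(1-2\alpha)})\}.$$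
   Context: $B(x,r)=\{y\in E\mid d(x,y)\le r\}$. A path $\mathbf x:[0,T]\to E$ is extended to $[0,\infty)$ by $\mathbf x_t=\mathbf x_T$ for $t>T$ (and correspondingly $\mathcal F_t=\mathcal F_T$ for $t>T$). $\|\mathbf x\|_{\alpha\text{-H\''ol};[s,t]}=\sup_{s\le u<v\le t}d(\mathbf x_u,\mathbf x_v)/|u-v|^\alpha$. For $\varepsilon>0$, $\|\mathbf x\|_{\alpha\text{-H\''ol},\ge\varepsilon;[s,t]}=\sup\{d(\mathbf x_u,\mathbf x_v)/|u-v|^\alpha : u,v\in[s,t],\ |u-v|\ge\varepsilon\}$, set to $0$ if there are no such $u,v$. H\''older stopping times: for $\varepsilon',\gamma'>0$ and $s\in[0,T]$ define $\tau_0=s$ and, for $n\ge1$, $\tau_n=\inf\{t>\tau_{n-1}\mid\|\mathbf x\|_{\alpha\text{-H\''ol},\ge\varepsilon';[\tau_{n-1},t]}\ge\gamma'\}$ (with $\inf\emptyset=\infty$). Any such $\tau_n=\tau_n^{\varepsilon',\gamma',s}$ (for any choice of $\varepsilon',\gamma',s,n$) is called a H\''older stopping time of $\mathbf x$; condition (1) is understood on the event $\{\tau<\infty\}$. *)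

(* Defs.v *)
From HB Require Import structures.
From mathcomp Require Import all_boot all_order all_algebra.
From mathcomp Require Import all_classical all_reals all_analysis measurable_realfun.

Set Implicit Arguments.
Unset Strict Implicit.
Unset Printing Implicit Defensive.

Import Order.TTheory GRing.Theory Num.Theory.
Import numFieldNormedType.Exports.

Local Open Scope classical_set_scope.
Local Open Scope ring_scope.

(* The library's completeType requires a distinguished point, hence the
   existential form of completeness. *)
Definition polish_metric (R : realType) (E : metricType R) : Prop :=
  (forall F : set_system E, ProperFilter F -> cauchy F ->
     exists l : E, F --> l) /\
  (exists2 D : set E, countable D & dense D).

Definition metric_closed_ball (R : realType) (E : metricType R) (x : E)
  (r : R) : set E := [set y | mdist x y <= r].

Definition is_cond_prob d (Omega : measurableType d) (R : realType)
    (P : probability Omega R) (G : set_system Omega) (A : set Omega)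
    (g : Omega -> R) : Prop :=
  [/\ forall B : set R, measurable B -> G (g @^-1` B),
      P.-integrable setT (EFin \o g) &
      forall B, G B -> (\int[P]_(w in B) (g w)%:E = P (A `&` B))%E].

(* A chosen version of P[A | G]; it is one by [cond_probP], and any two
   versions agree almost surely. *)
Definition cond_prob d (Omega : measurableType d) (R : realType)
    (P : probability Omega R) (G : set_system Omega) (A : set Omega) :
    Omega -> R :=
  xget (cst 0) [set g | is_cond_prob P G A g].

Lemma cond_probP d (Omega : measurableType d) (R : realType)
    (P : probability Omega R) (G : set_system Omega) (A : set Omega) :
  sigma_algebra setT G -> G `<=` measurable -> measurable A ->
  is_cond_prob P G A (cond_prob P G A).
Proof.
move=> sG Gm mA; apply: xgetPex.
pose T : measurableType G.-sigma := g_sigma_algebraType G.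
have GE (B : set T) : measurable B = G B.
  by rewrite -[in RHS](sigma_algebra_id sG).
pose j : Omega -> T := idfun.
have mj : measurable_fun [set: Omega] j.
  by move=> _ B; rewrite GE setTI => /Gm.
pose mu0 : {measure set T -> \bar R} := pushforward P j.
pose mu := mu0 mj.
pose nu0 : {measure set T -> \bar R} := pushforward (mrestr P mA) j.
pose nu := nu0 mj.
have muf : fin_num_fun mu.
  by move=> B; rewrite GE => /Gm mB; exact: (fin_num_measure P).
have nuf : fin_num_fun nu.
  move=> B; rewrite GE => /Gm mB.
  by apply: (fin_num_measure P); exact: measurableI.
have finite_of (m : {measure set T -> \bar R}) (mf : fin_num_fun m) :
    exists m' : {finite_measure set T -> \bar R}, forall B, m' B = m B.
  have moo : (m setT < +oo)%E by rewrite ltey_eq mf.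
  by exists (mfrestr measurableT moo) => B; exact: congr1 (setIT B).
have [mu' mu'E] := finite_of mu muf; have [nu' nu'E] := finite_of nu nuf.
have numu : charge_of_finite_measure nu' `<< mu'.
  apply/null_content_dominatesP => B mB muB0.
  have {}muB0 : mu B = 0%E by rewrite -mu'E.
  have mB' : measurable (B : set Omega) by apply: Gm; rewrite -GE.
  rewrite /charge_of_finite_measure nu'E.
  apply/eqP; rewrite -measure_le0 -[X in (_ <= X)%E]muB0.
  by apply: (le_measure P); rewrite ?inE//; exact: measurableI.
have [f [ffin fi fE]] : exists f : T -> \bar R,
    [/\ forall w, f w \is a fin_num, mu'.-integrable [set: T] f &
    forall B, measurable B -> (\int[mu']_(w in B) f w = nu' B)%E].
  exists (Radon_Nikodym (charge_of_finite_measure nu') mu'); split.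
  - by move=> w; exact: Radon_Nikodym_fin_num.
  - exact: Radon_Nikodym_integrable.
  - by move=> B mB; rewrite -Radon_Nikodym_integral.
have mf := measurable_int _ fi.
have intE (B : set T) (h : T -> \bar R) :
    (\int[mu']_(w in B) h w = \int[pushforward P j]_(w in B) h w)%E.
  by apply: (eq_measure_integral mu) => C _ _; exact: mu'E.
have fij : P.-integrable setT (f \o j).
  apply/integrableP; split; first exact: (measurableT_comp mf mj).
  have /integrableP[_] := fi; rewrite intE ge0_integral_pushforward//.
  exact: measurableT_comp.
have fK w : (fine (f w))%:E = f w by rewrite fineK.
exists (fun w => fine (f w)); split.
- move=> B mB; rewrite -GE -[X in measurable X]setTI.
  exact: (measurableT_comp (fine_measurable _) mf).
- by apply: eq_integrable fij => // w _; rewrite /= fK.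
- move=> B GB.
  have mB : measurable (B : set T) by rewrite GE.
  under eq_integral do rewrite fK.
  rewrite setIC -[RHS](nu'E B) -fE// intE (integral_pushforward mj)//.
  by apply: (integrableS measurableT) => //; exact: Gm.
Qed.

(* Filtration on [0, T]; the values of [F] outside [0, T] are irrelevant. *)
Definition is_filtration d (Omega : measurableType d) (R : realType) (T : R)
    (F : R -> set_system Omega) : Prop :=
  (forall t, 0 <= t <= T ->
     sigma_algebra setT (F t) /\ F t `<=` measurable) /\
  (forall s t, 0 <= s -> s <= t -> t <= T -> F s `<=` F t).

Definition adapted d (Omega : measurableType d) (R : realType)
    (E : metricType R) (T : R) (F : R -> set_system Omega)
    (X : R -> Omega -> E) : Prop :=
  forall t, 0 <= t <= T ->
    forall B : set E, <<s [set U : set E | open U] >> B -> F t (X t @^-1` B).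

Definition continuous_paths (Omega : Type) (R : realType) (E : metricType R)
    (T : R) (X : R -> Omega -> E) : Prop :=
  forall w, {within `[0, T], continuous (X^~ w)}.

(* Constant extension past [T], for paths and for filtrations alike. *)
Definition extend_after (R : realType) (V : Type) (T : R) (x : R -> V) :
    R -> V :=
  fun t => x (Num.min t T).

Definition holder_norm (R : realType) (E : metricType R) (alpha s t : R)
    (x : R -> E) : \bar R :=
  ereal_sup [set z | exists u v, [/\ s <= u, u < v, v <= t &
    z = (mdist (x u) (x v) / `|u - v| `^ alpha)%:E]].

(* The maximum with 0 only matters when the set is empty. *)
Definition holder_norm_ge (R : realType) (E : metricType R)
    (alpha eps s t : R) (x : R -> E) : \bar R :=
  maxe 0%E (ereal_sup [set z | exists u v,
    [/\ s <= u <= t, s <= v <= t, eps <= `|u - v| &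
    z = (mdist (x u) (x v) / `|u - v| `^ alpha)%:E]]).

(* [fine] is harmless: the set is empty when the previous time is +oo. *)
Fixpoint holder_time (R : realType) (E : metricType R) (alpha T : R)
    (x : R -> E) (eps gamma s : R) (n : nat) : \bar R :=
  if n is m.+1 then
    let tau := holder_time alpha T x eps gamma s m in
    ereal_inf [set t%:E | t in [set t : R | (tau < t%:E)%E /\
      (gamma%:E <=
        holder_norm_ge alpha eps (fine tau) t (extend_after T x))%E]]
  else s%:E.

Definition holder_stopping_time (Omega : Type) (R : realType)
    (E : metricType R) (alpha T : R) (X : R -> Omega -> E)
    (tau : Omega -> \bar R) : Prop :=
  exists eps gamma s n, [/\ 0 < eps, 0 < gamma, 0 <= s <= T &
    forall w, tau w = holder_time alpha T (X^~ w) eps gamma s n].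

Definition stopped_sigma_algebra d (Omega : measurableType d) (R : realType)
    (T : R) (F : R -> set_system Omega) (tau : Omega -> \bar R) :
    set_system Omega :=
  [set A | measurable A /\ forall t : R, 0 <= t ->
     extend_after T F t (A `&` [set w | (tau w <= t%:E)%E])].

(* The event {tau < oo, sup_(t in [tau, tau + eps]) d(X_tau, X_t) > c}. *)
Definition exit_event (Omega : Type) (R : realType) (E : metricType R)
    (T : R) (X : R -> Omega -> E) (tau : Omega -> \bar R) (eps c : R) :
    set Omega :=
  [set w | (tau w < +oo)%E /\
    (c%:E < ereal_sup [set (mdist (extend_after T (X^~ w) (fine (tau w)))
                                  (extend_after T (X^~ w) t))%:E
                      | t in `[fine (tau w), (fine (tau w) + eps)%R]])%E].

(* Main.v *)
Require Import Defs.
From HB Require Import structures.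
From mathcomp Require Import all_boot all_order all_algebra.
From mathcomp Require Import all_classical all_reals all_analysis.
From mathcomp Require Import ring lra.

Import Order.TTheory GRing.Theory Num.Theory.
Import numFieldNormedType.Exports.

Local Open Scope classical_set_scope.
Local Open Scope ring_scope.

(** Cut [[0, T]] into pieces of length [h] of order [gamma^(2/(1-2 alpha))].
    On a piece [[s, s+h]], joining [u < v] through the dyadic points of mesh
    [h/2^n], where [h/2^(n+1) < v-u <= h/2^n], bounds the Hoelder norm by the
    oscillations of the path over dyadic intervals.  Condition (1) at the
    deterministic dyadic times and a union bound show that, given [F_s], the
    norm on the piece exceeds [gamma/4] with probability at most
    [q = min(c2, 1)/2], because [gamma^2/h^(1-2 alpha)] is large.  By (2) a path
    in [B(x, C2 h^(1/2))] at time [s] is there again at time [s+h] with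
    probability at least [c2], so both good events occur with probability at
    least [q]; iterating over the [O(T/h)] pieces yields the lower bound.  On
    the resulting event the pieces fit together: points at distance at least
    [h] in time are compared through the ball, whose radius is at most
    [gamma h^alpha/8].  If [T <= h] a single piece suffices and the ball plays
    no role. *)

(** * Hoelder bounds for a single path *)

Lemma uniform_piece {R : realFieldType} (h v : R) (N : nat) :
  0 < h -> 0 <= v -> v <= N.+1%:R * h ->
  exists2 j, (j < N.+1)%N & j%:R * h <= v <= j.+1%:R * h.
Proof.
move=> h0 v0; elim: N => [|N IH] vN; first by exists 0%N; rewrite // mul0r v0.
have [/IH[j jN jv]|Nv] := leP v (N.+1%:R * h).
  by exists j => //; rewrite ltnW.
by exists N.+1 => //; rewrite vN ltW.
Qed.

Lemma dyadic_piece_le {R : realFieldType} (h : R) (n k : nat) :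
  0 < h -> (k < 2 ^ n)%N -> k.+1%:R * (h / 2 ^+ n) <= h.
Proof.
move=> h0 kn; rewrite mulrA ler_pdivrMr ?exprn_gt0// mulrC ler_pM2l//.
by rewrite -natrX ler_nat.
Qed.

Lemma powR_le2 {R : realType} (alpha x y : R) :
  0 < alpha < 1 -> 0 <= x -> x <= 2 * y -> x `^ alpha <= 2 * y `^ alpha.
Proof.
move=> /andP[a0 a1] x0 xy; have y0 : 0 <= y by lra.
apply: (le_trans (y := (2 * y) `^ alpha)).
  by apply: ge0_ler_powR; rewrite ?nnegrE//; lra.
rewrite powRM// ler_wpM2r ?powR_ge0//.
by rewrite -[leRHS]powRr1// ler_powR//; lra.
Qed.

(** The hypothesis controls [x] at all times of a dyadic interval, so a single scale
    [e = h / 2 ^+ n] comparable to [v - u] suffices. At this scale [u] and [v] lie in the same or in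
    adjacent intervals, so at most three distances of size [b * e ^ alpha] add up; [e < 2 * (v - u)]
    costs another factor 2, whence 6. *)
Lemma holder_of_dyadic {R : realType} {E : metricType R} (x : R -> E)
    (alpha s h b : R) :
  0 < alpha < 1 -> 0 < h ->
  (forall n k, (k < 2 ^ n)%N -> forall t : R,
     s + k%:R * (h / 2 ^+ n) <= t <= s + k%:R * (h / 2 ^+ n) + h / 2 ^+ n ->
     mdist (x (s + k%:R * (h / 2 ^+ n))) (x t) <= b * (h / 2 ^+ n) `^ alpha) ->
  forall u v, s <= u -> u < v -> v <= s + h ->
    mdist (x u) (x v) <= 6 * b * `|u - v| `^ alpha.
Proof.
move=> al h0 dy u v su uv vs.
have b0 : 0 <= b.
  have := dy 0%N 0%N isT s; rewrite expr0 divr1 mul0r addr0 lexx lerDl ltW//.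
  move=> /(_ isT); rewrite mdistxx pmulr_lge0// powR_gt0//.
have vu0 : 0 < v - u by rewrite subr_gt0.
(* The witness works since [h / (v - u) < m + 1 < 2 ^ (m + 1)] for [m] its integer part; minimality
   then gives [v - u <= h / 2 ^+ n]. *)
have /ex_minnP[n nP nmin] : exists n, h / 2 ^+ n.+1 < v - u.
  exists (Num.trunc (h / (v - u))); rewrite ltr_pdivrMr ?exprn_gt0//.
  rewrite mulrC -ltr_pdivrMr//.
  have /truncn_itv/andP[_ /lt_le_trans] : 0 <= h / (v - u).
    by rewrite divr_ge0// ltW.
  by apply; rewrite -natrX ler_nat ltnW// ltn_expl.
have vun : v - u <= h / 2 ^+ n.
  case: n nP nmin => [|n] nP nmin; first by rewrite expr0 divr1; lra.
  by rewrite leNgt; apply/negP => /nmin; rewrite ltnn.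
set e := h / 2 ^+ n in vun.
have e0 : 0 < e by rewrite divr_gt0// exprn_gt0.
have ne : h = (2 ^ n)%:R * e.
  by rewrite natrX /e mulrC divfK// expf_neq0.
have ev : e < 2 * (v - u).
  by move: nP; rewrite exprS invfM mulrCA -/e; lra.
have {}dy := dy n; rewrite -/e in dy.
have [k kn /andP[ku uk]] : exists2 k, (k < 2 ^ n)%N &
    k%:R * e <= u - s < k.+1%:R * e.
  have us0 : 0 <= (u - s) / e by rewrite divr_ge0 ?subr_ge0// ltW.
  have /andP[k1 k2] := truncn_itv us0.
  exists (Num.trunc ((u - s) / e)); last first.
    by rewrite -ler_pdivlMr// k1 -ltr_pdivrMr.
  rewrite -(ltr_nat R) (le_lt_trans k1)// ltr_pdivrMr// -ne; lra.
have ea : e `^ alpha <= 2 * `|u - v| `^ alpha.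
  by apply: powR_le2 => //; rewrite ?ltW// distrC gtr0_norm.
have k1E : k.+1%:R * e = k%:R * e + e by rewrite -addn1 natrD mulrDl mul1r.
suff : mdist (x u) (x v) <= 3 * (b * e `^ alpha).
  by have := ler_wpM2l b0 ea; lra.
have be0 : 0 <= b * e `^ alpha by rewrite mulr_ge0// powR_ge0.
have xu : mdist (x (s + k%:R * e)) (x u) <= b * e `^ alpha.
  by apply: dy => //; lra.
have [vk|kv] := leP v (s + k.+1%:R * e).
  have xv : mdist (x (s + k%:R * e)) (x v) <= b * e `^ alpha.
    by apply: dy => //; lra.
  have := metric_triangle (x u) (x (s + k%:R * e)) (x v).
  by rewrite (metric_sym (x u) (x (s + k%:R * e))); lra.
have kn1 : (k.+1 < 2 ^ n)%N.
  rewrite -(ltr_nat R) -(ltr_pM2r e0) -ne; lra.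
have xk : mdist (x (s + k%:R * e)) (x (s + k.+1%:R * e)) <= b * e `^ alpha.
  by apply: dy => //; lra.
have xv : mdist (x (s + k.+1%:R * e)) (x v) <= b * e `^ alpha.
  by apply: dy => //; lra.
have := metric_triangle (x u) (x (s + k%:R * e)) (x v).
have := metric_triangle (x (s + k%:R * e)) (x (s + k.+1%:R * e)) (x v).
by rewrite (metric_sym (x u) (x (s + k%:R * e))); lra.
Qed.

(** The path from [u] to [v] is cut at the right end of the piece of [u] and the left end of the
    piece of [v]. If these grid points differ, then [v - u] is at least [h], and passing through [y]
    bounds their distance by [2 * rho <= a * h ^ alpha]. Each of the three parts thus costs at most
    [a * |u - v| ^ alpha]. *)
Lemma holder_glue {R : realType} {E : metricType R} (x : R -> E) (y : E)
    (alpha h a rho : R) (N : nat) :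
  0 < alpha -> 0 < h -> 0 <= a -> 2 * rho <= a * h `^ alpha ->
  (forall k u v, (k < N.+1)%N -> k%:R * h <= u -> u < v -> v <= k%:R * h + h ->
     mdist (x u) (x v) <= a * `|u - v| `^ alpha) ->
  (forall k, (0 < k < N.+1)%N -> mdist y (x (k%:R * h)) <= rho) ->
  forall u v, 0 <= u -> u < v -> v <= N.+1%:R * h ->
    mdist (x u) (x v) <= 3 * a * `|u - v| `^ alpha.
Proof.
move=> al h0 a0 rhoa hx hy u v u0 uv vN.
have SE k : k.+1%:R * h = k%:R * h + h by rewrite -addn1 natrD mulrDl mul1r.
have pw w z w' z' : w < z -> w' <= w -> z <= z' ->
    a * `|w - z| `^ alpha <= a * `|w' - z'| `^ alpha.
  move=> wz ww zz; rewrite ler_wpM2l// ge0_ler_powR ?nnegrE ?(ltW al)//.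
  by rewrite (distrC w) (distrC w') !gtr0_norm ?subr_gt0; lra.
have hx' k w z : (k < N.+1)%N -> k%:R * h <= w -> w <= z -> z <= k%:R * h + h ->
    mdist (x w) (x z) <= a * `|w - z| `^ alpha.
  move=> kN kw; rewrite le_eqVlt => /orP[/eqP <- _|]; last exact: hx.
  by rewrite mdistxx mulr_ge0 ?powR_ge0.
have uvN : u <= N.+1%:R * h by lra.
have [i iN] := uniform_piece h u N h0 u0 uvN; rewrite SE => /andP[iu ui].
have v0 : 0 <= v by lra.
have [j jN] := uniform_piece h v N h0 v0 vN; rewrite SE => /andP[jv vj].
have uva : 0 <= a * `|u - v| `^ alpha by rewrite mulr_ge0 ?powR_ge0.
have [vi|iv] := leP v (i%:R * h + h).
  by apply: (le_trans (hx i u v iN iu uv vi)); lra.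
have ij : (i < j)%N.
  rewrite ltnNge; apply/negP; rewrite -(ler_nat R) => ji.
  have := ler_wpM2r (ltW h0) ji; lra.
have leuv w z : u <= w -> w < z -> z <= v ->
    a * `|w - z| `^ alpha <= a * `|u - v| `^ alpha by move=> *; exact: pw.
have le_a k w z : (k < N.+1)%N -> k%:R * h <= w -> w <= z ->
    z <= k%:R * h + h -> u <= w -> z <= v ->
    mdist (x w) (x z) <= a * `|u - v| `^ alpha.
  move=> kN kw; rewrite le_eqVlt => /orP[/eqP -> _ _ _|wz zk uw zv].
    by rewrite mdistxx.
  exact: (le_trans (hx _ _ _ kN kw wz zk) (leuv _ _ uw wz zv)).
have x1 : mdist (x u) (x (i.+1%:R * h)) <= a * `|u - v| `^ alpha.
  by apply: (le_a i); rewrite ?SE//; lra.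
have ji1 : i.+1%:R * h <= j%:R * h by rewrite ler_wpM2r ?(ltW h0)// ler_nat.
have x3 : mdist (x (j%:R * h)) (x v) <= a * `|u - v| `^ alpha.
  by apply: (le_a j); rewrite ?SE//; move: ji1; rewrite ?SE; lra.
have := metric_triangle (x u) (x (i.+1%:R * h)) (x v).
have := metric_triangle (x (i.+1%:R * h)) (x (j%:R * h)) (x v).
suff : mdist (x (i.+1%:R * h)) (x (j%:R * h)) <= a * `|u - v| `^ alpha by lra.
have := ij; rewrite leq_eqVlt => /orP[/eqP ->|i1j]; first by rewrite mdistxx.
have d1 : mdist y (x (i.+1%:R * h)) <= rho.
  by rewrite hy// (leq_trans i1j)// ltnW.
have d2 : mdist y (x (j%:R * h)) <= rho by rewrite hy// jN (leq_trans _ i1j).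
have := metric_triangle (x (i.+1%:R * h)) y (x (j%:R * h)).
rewrite (metric_sym (x (i.+1%:R * h)) y).
suff : a * h `^ alpha <= a * `|u - v| `^ alpha by lra.
rewrite ler_wpM2l// ge0_ler_powR ?nnegrE ?(ltW al) ?(ltW h0)//.
have : i.+2%:R * h <= j%:R * h by rewrite ler_wpM2r ?(ltW h0)// ler_nat.
by rewrite !SE distrC gtr0_norm; lra.
Qed.

(** * Measurability *)

Lemma continuous_path_approx {R : realType} {E : metricType R} {T : R}
    {x : R -> E} (e t : R) :
  {within `[0, T], continuous x} -> 0 <= t <= T -> 0 < e ->
  exists2 delta, 0 < delta & forall u, 0 <= u <= T -> `|t - u| < delta ->
    mdist (x t) (x u) < e.
Proof.
move=> /subspace_continuousP/(_ t) xt tT e0.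
have /xt/(_ _ (nbhsx_ballx _ e e0)) : `[0, T]%classic t by rewrite /= in_itv.
rewrite /nbhs/= /within/= => /nbhs_ballP[delta /= delta0 H].
exists delta => // u uT tu.
have := H u tu; rewrite /= in_itv/= ballEmdist; exact.
Qed.

(** Both rational times lie strictly inside the interval, so they inherit its constraints and their
    gap is below [v - u]; this lets suprema over real times be replaced by countable ones. *)
Lemma rat_path_approx {R : realType} {E : metricType R} {T : R} {x : R -> E}
    (e u v : R) :
  {within `[0, T], continuous x} -> 0 <= u -> u < v -> v <= T -> 0 < e ->
  exists p q : rat, [/\ u < ratr p < (ratr q : R), ratr q < v,
    mdist (x u) (x (ratr p)) < e & mdist (x v) (x (ratr q)) < e].
Proof.
move=> xc u0 uv vT e0.
have uT : 0 <= u <= T by lra.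
have {}vT : 0 <= v <= T by lra.
have [d1 d10 H1] := continuous_path_approx e u xc uT e0.
have [d2 d20 H2] := continuous_path_approx e v xc vT e0.
have [um mv] := midf_lt uv.
have /rat_in_itvoo[p] : u < Num.min ((u + v) / 2) (u + d1).
  by rewrite lt_min um; lra.
rewrite in_itv/= lt_min => /and3P[up pm pd].
have /rat_in_itvoo[q] : Num.max ((u + v) / 2) (v - d2) < v.
  by rewrite gt_max mv; lra.
rewrite in_itv/= gt_max => /andP[/andP[mq dq] qv].
exists p, q; split; rewrite ?up ?uq//.
- exact: lt_trans mq.
- by apply: H1; [lra|rewrite distrC gtr0_norm; lra].
- by apply: H2; [lra|rewrite gtr0_norm; lra].
Qed.

Lemma open_mdist_lt {R : realType} {E : metricType R} (y : E) (c : R) :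
  open [set z | mdist y z < c].
Proof.
rewrite openE => z /= yz; apply/nbhs_ballP.
exists (c - mdist y z); first by rewrite /= subr_gt0.
move=> u; rewrite ballEmdist/= => zu.
have := metric_triangle y z u; lra.
Qed.

Lemma open_mdist_gt {R : realType} {E : metricType R} (y : E) (c : R) :
  open [set z | c < mdist y z].
Proof.
rewrite openE => z /= yz; apply/nbhs_ballP.
exists (mdist y z - c); first by rewrite /= subr_gt0.
move=> u; rewrite ballEmdist/= => zu.
have := metric_triangle y u z; rewrite (metric_sym u z); lra.
Qed.

(** By separability, [c < mdist (Y w) (Z w)] holds exactly when some [y] in [D] and some rational
    [q] satisfy [mdist y (Y w) < q] and [c + q < mdist y (Z w)]. This is a countable union of
    intersections of preimages of open sets, with no recourse to a product sigma-algebra on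
    pairs. *)
Lemma measurable_mdist_gt {d} {Omega : measurableType d} {R : realType}
    {E : metricType R} (Y Z : Omega -> E) (c : R) :
  (exists2 D : set E, countable D & dense D) ->
  (forall U, open U -> measurable (Y @^-1` U)) ->
  (forall U, open U -> measurable (Z @^-1` U)) ->
  measurable [set w | c < mdist (Y w) (Z w)].
Proof.
move=> [D cD dD] mY mZ.
have near_D w e : 0 < e -> exists2 y, D y & mdist y (Y w) < e.
  move=> e0; have [|y [/= Yy Dy]] := dD _ _ (open_mdist_lt (Y w) e).
    by exists (Y w); rewrite /= mdistxx.
  by exists y => //; rewrite metric_sym.
case/pfcard_geP: cD => [D0|[f]].
  rewrite (_ : [set _ | _] = set0); first exact: measurable0.
  by rewrite -subset0 => w _; have [y] := near_D w 1 ltr01; rewrite D0.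
rewrite (_ : [set _ | _] = \bigcup_n \bigcup_q
    ((Y @^-1` [set z | mdist (f n) z < ratr q]) `&`
     (Z @^-1` [set z | c + ratr q < mdist (f n) z]))); last first.
  apply/seteqP; split=> [w /= cYZ|w [n _ [q _ [/= Yq Zq]]]]; last first.
    have := metric_triangle (f n) (Y w) (Z w); lra.
  (* Half the gap leaves room for a rational: [mdist y (Y w)] below it forces [mdist y (Z w) - c]
     above it. *)
  have e0 : 0 < (mdist (Y w) (Z w) - c) / 2 by lra.
  have [y Dy yY] := near_D w _ e0.
  have [n _ fn] := @surj _ _ _ _ f y Dy.
  have tri := metric_triangle (Y w) y (Z w).
  have /rat_in_itvoo[q] : mdist y (Y w) < mdist y (Z w) - c.
    by rewrite (metric_sym (Y w) y) in tri; lra.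
  rewrite in_itv/= => /andP[q1 q2].
  by exists n => //; exists q => //; rewrite /= fn; split=> //; lra.
apply: bigcupT_measurable => n; apply: bigcupT_measurable_rat => q.
apply: measurableI; [apply: mY; exact: open_mdist_lt|].
by apply: mZ; exact: open_mdist_gt.
Qed.

(** Continuity reduces the supremum to rational times. Measurability of [X t] is required only up to
    [s + eps], so that the sigma-algebra of [Omega] can later be taken to be a member of the
    filtration. *)
Lemma measurable_exit_event_cst {d} {Omega : measurableType d} {R : realType}
    {E : metricType R} (T : R) (X : R -> Omega -> E) (s eps c : R) :
  (exists2 D : set E, countable D & dense D) ->
  continuous_paths T X ->
  (forall t, 0 <= t <= s + eps ->
    forall U, open U -> measurable (X t @^-1` U)) ->
  0 <= s -> 0 < eps -> s + eps <= T -> 0 < c ->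
  measurable (exit_event T X (fun=> s%:E) eps c).
Proof.
move=> sE cX mX s0 eps0 sT c0.
pose A (q : rat) := if s <= ratr q <= s + eps then
    [set w | c < mdist (X s w) (X (ratr q) w)] else set0.
have -> : exit_event T X (fun=> s%:E) eps c = \bigcup_q A q.
  apply/seteqP; split=> [w []|w [q _]]; last first.
    rewrite /A; case: ifP => // sq cX0; split; first exact: ltry.
    apply/ereal_sup_gtP; exists (mdist (X s w) (X (ratr q) w))%:E => //=.
    exists (ratr q); first by rewrite /= in_itv.
    by rewrite /extend_after !min_l//; lra.
  move=> _ /ereal_sup_gtP[_ [t + <-]]; rewrite /= in_itv/= lte_fin => st.
  rewrite /extend_after !min_l; [|lra..] => ct.
  (* The time [t = s] is excluded by [0 < c], which leaves an interval in which to find a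
     rational. *)
  have {}st : s < t <= s + eps.
    case/andP: st => st ->; rewrite lt_neqAle st !andbT.
    by apply/eqP => st'; move: ct; rewrite st' mdistxx; lra.
  have e0 : 0 < mdist (X s w) (X t w) - c by lra.
  have [//|||p [q [pq qt _ Xq]]] := rat_path_approx _ s t (cX w) _ _ _ e0;
    [lra..|].
  exists q => //; rewrite /A ifT; last by lra.
  have := metric_triangle (X s w) (X (ratr q) w) (X t w).
  by rewrite /= (metric_sym (X (ratr q) w)); lra.
apply: bigcupT_measurable_rat => q; rewrite /A; case: ifPn => // sq.
by apply: measurable_mdist_gt => // U oU; apply: mX => //; lra.
Qed.

Lemma holder_norm_leP {R : realType} {E : metricType R} (alpha s t r : R)
    (x : R -> E) :
  (holder_norm alpha s t x <= r%:E)%E <->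
  (forall u v, s <= u -> u < v -> v <= t ->
    mdist (x u) (x v) <= r * `|u - v| `^ alpha).
Proof.
have uv0 (u v : R) : u < v -> 0 < `|u - v| `^ alpha.
  by move=> uv; rewrite powR_gt0// distrC gtr0_norm ?subr_gt0.
split=> [xr u v su uv vt|xr].
  rewrite -ler_pdivrMr ?uv0// -lee_fin; apply: le_trans xr.
  by apply: ereal_sup_ubound; exists u, v.
apply: ge_ereal_sup => _ [u [v [su uv vt ->]]].
by rewrite lee_fin ler_pdivrMr ?uv0//; exact: xr.
Qed.

Lemma holder_bound_of_rat {R : realType} {E : metricType R} {T : R} {x : R -> E}
    (alpha r : R) : 0 < alpha -> {within `[0, T], continuous x} ->
  (forall p q : rat, 0 <= ratr p :> R -> ratr p < ratr q :> R -> ratr q <= T ->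
    mdist (x (ratr p)) (x (ratr q)) <= r * `|ratr p - ratr q| `^ alpha) ->
  forall u v, 0 <= u -> u < v -> v <= T ->
    mdist (x u) (x v) <= r * `|u - v| `^ alpha.
Proof.
move=> al xc H u v u0 uv vT; rewrite leNgt; apply/negP => ruv.
set D := mdist (x u) (x v) in ruv.
have e0 : 0 < (D - r * `|u - v| `^ alpha) / 2 by lra.
have [p [q [/andP[up pq] qv Xp Xq]]] := rat_path_approx _ _ _ xc u0 uv vT e0.
have {}H : mdist (x (ratr p)) (x (ratr q)) <= r * `|ratr p - ratr q| `^ alpha.
  by apply: H => //; lra.
have pq0 : 0 < `|ratr p - ratr q| `^ alpha :> R.
  by rewrite powR_gt0// distrC gtr0_norm ?subr_gt0.
(* The sign of [r] is forced by the bound itself, distances being nonnegative. *)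
have r0 : 0 <= r by rewrite -(pmulr_lge0 _ pq0) (le_trans _ H)// mdist_ge0.
have : r * `|ratr p - ratr q| `^ alpha <= r * `|u - v| `^ alpha.
  rewrite ler_wpM2l// ge0_ler_powR ?nnegrE ?(ltW al)//.
  by rewrite distrC (distrC u) !gtr0_norm; lra.
have := metric_triangle (x u) (x (ratr p)) (x v).
have := metric_triangle (x (ratr p)) (x (ratr q)) (x v).
rewrite (metric_sym (x (ratr q)) (x v)) -/D; lra.
Qed.

(** The norm is below [gamma] exactly when it is at most some rational [r < gamma], and for
    continuous paths the latter is a countable intersection of conditions on rational pairs of
    times. *)
Lemma measurable_holder_norm_lt {d} {Omega : measurableType d} {R : realType}
    {E : metricType R} (T : R) (X : R -> Omega -> E) (alpha gamma : R) :
  (exists2 D : set E, countable D & dense D) ->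
  continuous_paths T X ->
  (forall t, 0 <= t <= T -> forall U, open U -> measurable (X t @^-1` U)) ->
  0 < alpha ->
  measurable [set w | (holder_norm alpha 0 T (X^~ w) < gamma%:E)%E].
Proof.
move=> sE cX mX al.
pose A (r p q : rat) :=
  if [&& 0 <= ratr p :> R, ratr p < ratr q :> R & ratr q <= T :> R] then
    [set w | ratr r * `|ratr p - ratr q| `^ alpha
             < mdist (X (ratr p) w) (X (ratr q) w)]
  else set0.
pose B (r : rat) :=
  if ratr r < gamma then ~` \bigcup_p \bigcup_q A r p q else set0.
have BE (r : rat) w : ratr r < gamma ->
    (holder_norm alpha 0 T (X^~ w) <= (ratr r)%:E)%E <-> B r w.
  rewrite /B => ->; rewrite holder_norm_leP; split=> [H [p _ [q _]]|H].
    rewrite /A; case: ifP => // /and3P[p0 pq qT] /=.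
    by rewrite ltNge H.
  apply: holder_bound_of_rat => // p q p0 pq qT.
  rewrite leNgt; apply/negP => pqX.
  by apply: H; exists p => //; exists q => //; rewrite /A p0 pq qT.
rewrite (_ : [set _ | _] = \bigcup_r B r).
  apply: bigcupT_measurable_rat => r; rewrite /B; case: ifP => // _.
  apply: measurableC; apply: bigcupT_measurable_rat => p.
  apply: bigcupT_measurable_rat => q.
  rewrite /A; case: ifP => // /and3P[p0 pq qT].
  by apply: measurable_mdist_gt => // U oU; apply: mX => //; lra.
apply/seteqP; split=> [w /= Xw|w [r _ Br]]; last first.
  have rg : ratr r < gamma by move: Br; rewrite /B; case: ifP.
  by move/(BE _ _ rg): Br => /le_lt_trans; apply; rewrite lte_fin.
suff [r [Xr rg]] : exists r : rat,
    (holder_norm alpha 0 T (X^~ w) <= (ratr r)%:E)%E /\ ratr r < gamma.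
  by exists r => //; apply/BE.
case: (holder_norm _ _ _ _) Xw => [l|//|_].
  rewrite lte_fin => /rat_in_itvoo[r]; rewrite in_itv/= => /andP[lr rg].
  by exists r; rewrite lee_fin ltW.
(* Here the norm is [-oo], the supremum of the empty set, so any rational below [gamma] serves. *)
have /rat_in_itvoo[r] : gamma - 1 < gamma by lra.
by rewrite in_itv/= => /andP[_ rg]; exists r; rewrite leNye.
Qed.

(** * Conditional probabilities *)

Lemma ae_le_integral {d} {Omega : measurableType d} {R : realType}
    (mu : {measure set Omega -> \bar R}) (D : set Omega)
    (f g : Omega -> \bar R) :
  measurable D -> mu.-integrable D f -> mu.-integrable D g ->
  {ae mu, forall w, (f w <= g w)%E} ->
  (\int[mu]_(w in D) f w <= \int[mu]_(w in D) g w)%E.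
Proof.
move=> mD fi gi [N [mN N0 fgN]].
rewrite (negligible_integral mN mD fi N0) (negligible_integral mN mD gi N0).
have mDN : measurable (D `\` N) by exact: measurableD.
apply: le_integral => //; try exact: (integrableS mD).
move=> w; rewrite inE => -[_ Nw].
by apply: contrapT => fg; apply/Nw/fgN.
Qed.

Section cond_prob_integral.
Context {d} {Omega : measurableType d} {R : realType} (P : probability Omega R)
  (G : set_system Omega) (A : set Omega).
Hypotheses (sG : sigma_algebra setT G) (Gm : G `<=` measurable)
  (mA : measurable A).

Let gP : is_cond_prob P G A (cond_prob P G A). Proof. exact: cond_probP. Qed.

Let gi B : measurable B -> P.-integrable B (EFin \o cond_prob P G A).
Proof. by move=> mB; apply: (integrableS measurableT) => //; case: gP. Qed.

Let indicI (k : R) (S B : set Omega) : measurable S -> measurable B ->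
  P.-integrable B (fun w => (k%:E * (\1_S w)%:E)%E).
Proof.
move=> mS mB; apply: (integrableS measurableT) => //.
by apply: (integrableZl measurableT); exact: integrable_indic.
Qed.

Let int_indic (k : R) (S B : set Omega) : measurable S -> measurable B ->
  (\int[P]_(w in B) (k%:E * (\1_S w)%:E) = k%:E * P (S `&` B))%E.
Proof.
move=> mS mB; rewrite integralZl ?integral_indic//.
by apply: (integrableS measurableT) => //; exact: integrable_indic.
Qed.

(** This bound and the next integrate an almost sure inequality over an event of [G]. The
    probabilistic argument can then be run on probabilities of events; [ae_cond_prob_ge] goes back
    at the end. *)
Lemma cond_prob_le (k : R) (B : set Omega) :
  {ae P, forall w, cond_prob P G A w <= k} -> G B ->
  (P (A `&` B) <= k%:E * P B)%E.
Proof.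
move=> gk GB; have mB := Gm _ GB; case: gP => _ _ <- //.
rewrite -(integral_cst P mB).
apply: ae_le_integral => //; first exact: gi.
exact: finite_measure_integrable_cst.
Qed.

Lemma cond_prob_ge (k : R) (S B : set Omega) :
  {ae P, forall w, k * \1_S w <= cond_prob P G A w} -> measurable S -> G B ->
  (k%:E * P (S `&` B) <= P (A `&` B))%E.
Proof.
move=> gk mS GB; have mB := Gm _ GB; case: gP => _ _ <- //.
rewrite -int_indic//.
apply: ae_le_integral => //; [exact: indicI|exact: gi].
Qed.

(** The integrated inequality is tested on the event [B] where the claim fails. There [k * \1_S - g]
    is positive but has integral at most 0, so [B] is negligible. *)
Lemma ae_cond_prob_ge (k : R) (S : set Omega) : G S ->
  (forall B, G B -> (k%:E * P (S `&` B) <= P (A `&` B))%E) ->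
  {ae P, forall w, k * \1_S w <= cond_prob P G A w}.
Proof.
move=> GS kS; set g := cond_prob P G A.
have [gG _ gint] := gP.
have GI U V : G U -> G V -> G (U `&` V).
  rewrite -(sigma_algebra_id sG).
  exact: (@measurableI _ (g_sigma_algebraType G)).
have GU U V : G U -> G V -> G (U `|` V).
  rewrite -(sigma_algebra_id sG).
  exact: (@measurableU _ (g_sigma_algebraType G)).
have GC U : G U -> G (~` U).
  rewrite -(sigma_algebra_id sG).
  exact: (@measurableC _ (g_sigma_algebraType G)).
pose B := [set w | g w < k * \1_S w].
have GB : G B.
  (* On [S] and on its complement the threshold is constant, equal to [k] and to 0, which shows that
     [B] belongs to [G]. *)
  rewrite (_ : B = (S `&` g @^-1` `]-oo, k[) `|` (~` S `&` g @^-1` `]-oo, 0[)).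
    by apply: (GU); apply: (GI) => //; [exact: gG|exact: GC|exact: gG].
  apply/seteqP; split=> w; rewrite /B /= !in_itv/= indicE.
    have [Sw|Sw] := pselect (S w);
      [rewrite mem_set// mulr1|rewrite memNset// mulr0].
      by left.
    by right.
  by case=> -[Sw]; [rewrite mem_set// mulr1|rewrite memNset// mulr0].
have mB := Gm _ GB; have mS := Gm _ GS.
pose f w := (k%:E * (\1_S w)%:E - (g w)%:E)%E.
have fi : P.-integrable B f.
  by apply: integrableB => //; [exact: indicI|exact: gi].
have f0 w : B w -> (0 < f w)%E.
  by rewrite /B /f /= -EFinM -EFinB lte_fin subr_gt0.
have : ae_eq P B f (cst 0%E).
  apply/(ae_eq_integral_abs P mB); first exact: measurable_int fi.
  apply/eqP; rewrite eq_le integral_ge0 ?andbT//.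
  under eq_integral => w; first (rewrite inE => /f0/ltW/gee0_abs ->; over).
  rewrite /f integralB//; [|exact: indicI|exact: gi].
  by rewrite int_indic// gint// sube_le0 kS.
apply: filterS => w fw; rewrite leNgt; apply/negP => gw.
by have := f0 _ gw; rewrite fw// ltxx.
Qed.

End cond_prob_integral.

(** The event that [s] is at most [t] is empty or everything according to whether [t < s]; testing
    at [t = s] gives one inclusion, monotonicity of the filtration the other. *)
Lemma stopped_sigma_algebra_cst {d} {Omega : measurableType d} {R : realType}
    (T : R) (F : R -> set_system Omega) (s : R) :
  is_filtration T F -> 0 <= s <= T ->
  stopped_sigma_algebra T F (fun=> s%:E) = F s.
Proof.
move=> [sF Fle] sT; apply/seteqP; split=> [A [_]|A FA].
  case/andP: sT => s0 sT /(_ s s0); rewrite /extend_after min_l//.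
  rewrite (_ : [set _ | _] = setT) ?setIT//.
  by apply/seteqP; split=> //= w; rewrite lexx.
split=> [|t t0]; first exact: (sF s sT).2.
rewrite /extend_after; have [st|ts] := leP s t.
  rewrite (_ : [set _ | _] = setT) ?setIT; last first.
    by apply/seteqP; split=> //= w; rewrite lee_fin.
  apply: Fle FA; rewrite ?ge_min ?le_min ?lexx ?orbT//; case/andP: sT => // *.
  exact/andP.
rewrite (_ : [set _ | _] = set0) ?setI0; last first.
  by rewrite -subset0 => w /=; rewrite lee_fin leNgt ts.
rewrite min_l; last by lra.
have /sF[[]] // : 0 <= t <= T by lra.
Qed.

(** * Oscillation and localization of the process *)

(** Of the powers of [2 ^+ n] to be absorbed, one counts the dyadic intervals of level [n] and one
    makes the levels summable. With [y = lam * (2 ^+ n) ^ beta], the bound [y ^ j / j! <= exp y] for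
    an integer [j >= 2 / beta] beats both. *)
Lemma expR_tail_weighted {R : realType} (beta C delta : R) :
  0 < beta -> 0 < C -> 0 < delta ->
  exists2 lam0 : R, 0 < lam0 & forall (lam : R) n, lam0 <= lam ->
    2 ^+ n * (C * expR (- (lam * (2 ^+ n) `^ beta))) <= delta / 2 ^+ n.+1.
Proof.
move=> beta0 C0 delta0.
pose m := Num.trunc (2 / beta).
have mb : 2 <= beta * m.+1%:R.
  have /truncn_itv/andP[_ /ltW] : 0 <= 2 / beta by rewrite divr_ge0// ltW.
  by rewrite ler_pdivrMr// mulrC.
have M0 : 0 < (m.+1)`!%:R :> R by rewrite ltr0n fact_gt0.
(* The summand 1 ensures [lam <= lam ^+ m.+1]; the other absorbs the constants and [delta]. *)
exists (1 + 2 * C * (m.+1)`!%:R / delta).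
  by rewrite ltr_wpDr// divr_ge0 ?mulr_ge0 ?ltW.
move=> lam n lamM.
have lamM' : 2 * C * (m.+1)`!%:R <= lam * delta.
  by rewrite -ler_pdivrMr//; lra.
have lam1 : 1 <= lam.
  apply: le_trans lamM; rewrite lerDl divr_ge0 ?mulr_ge0 ?ltW//.
set Q := 2 ^+ n.
have Q1 : 1 <= Q :> R by rewrite exprn_ege1// ler1n.
have Q0 : 0 < Q by lra.
set y := lam * Q `^ beta.
have Qm : Q ^+ 2 <= (Q `^ beta) ^+ m.+1.
  rewrite -(powR_mulrn m.+1 (powR_ge0 _ _)) -powRrM.
  by rewrite -(powR_mulrn 2 (ltW Q0)) ler_powR.
have ym : lam * Q ^+ 2 <= y ^+ m.+1.
  rewrite exprMn; apply: ler_pM; rewrite ?exprn_ge0 ?ler_eXnr//; lra.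
have y0 : 0 <= y by rewrite mulr_ge0 ?powR_ge0//; lra.
have zM : lam * Q ^+ 2 * expR (- y) <= (m.+1)`!%:R.
  have := expR_ge1Dxn m y0 => ey.
  have {}ey : y ^+ m.+1 / (m.+1)`!%:R <= expR y by lra.
  rewrite ler_pdivrMr// in ey.
  rewrite expRN ler_pdivrMr ?expR_gt0// [leRHS]mulrC; exact: le_trans ey.
rewrite exprS -/Q ler_pdivlMr; last by rewrite mulr_gt0.
rewrite -(ler_pM2l (x := lam)); last by lra.
apply: le_trans lamM'.
rewrite (_ : lam * _ = 2 * C * (lam * Q ^+ 2 * expR (- y))); last first.
  by rewrite /y; ring.
by rewrite ler_pM2l// mulr_gt0.
Qed.

(** The bad event of the piece from [s] to [s + h]. It is built from exit events at deterministic
    times, to which assumption (1) applies one by one. *)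
Definition dyadic_osc {Omega : Type} {R : realType} {E : metricType R}
    (T : R) (X : R -> Omega -> E) (alpha b s h : R) : set Omega :=
  \bigcup_n \bigcup_(k < 2 ^ n)
    exit_event T X (fun=> (s + k%:R * (h / 2 ^+ n))%:E) (h / 2 ^+ n)
      (b * (h / 2 ^+ n) `^ alpha).

Lemma holder_of_not_dyadic_osc {Omega : Type} {R : realType} {E : metricType R}
    (T : R) (X : R -> Omega -> E) (alpha b s h : R) (w : Omega) :
  0 < alpha < 1 -> 0 < h -> s + h <= T -> ~ dyadic_osc T X alpha b s h w ->
  forall u v, s <= u -> u < v -> v <= s + h ->
    mdist (X u w) (X v w) <= 6 * b * `|u - v| `^ alpha.
Proof.
move=> al h0 sT nb; apply: (holder_of_dyadic (X^~ w)) => // n k kn t.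
set e := h / 2 ^+ n; set sk := s + _ => st.
have e0 : 0 < e by rewrite divr_gt0// exprn_gt0.
have kh : k.+1%:R * e <= h by exact: dyadic_piece_le.
have skT : sk + e <= T.
  by move: kh; rewrite /sk -addn1 natrD mulrDl mul1r; lra.
rewrite leNgt; apply/negP => bX; apply: nb.
exists n => //; exists k => //; split; first exact: ltry.
apply/ereal_sup_gtP.
exists (mdist (X sk w) (X t w))%:E; last by rewrite lte_fin.
exists t; first by rewrite /= in_itv.
by rewrite /extend_after /= !min_l// -/e -/sk; lra.
Qed.

Section filtered_process.
Context {d} {Omega : measurableType d} {R : realType} {E : metricType R}
  (P : probability Omega R) (T : R) (F : R -> set_system Omega)
  (X : R -> Omega -> E).
Hypotheses (sepE : exists2 D : set E, countable D & dense D)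
  (filF : is_filtration T F) (adX : adapted T F X) (cX : continuous_paths T X).

Lemma filtration_measurable (t : R) A : 0 <= t <= T -> F t A -> measurable A.
Proof. by move=> /(filF.1 t)[_]; exact. Qed.

Lemma filtration_setI (t : R) A B : 0 <= t <= T ->
  F t A -> F t B -> F t (A `&` B).
Proof.
move=> /(filF.1 t)[sF _]; rewrite -(sigma_algebra_id sF).
exact: (@measurableI _ (g_sigma_algebraType (F t))).
Qed.

Lemma filtration_setC (t : R) A : 0 <= t <= T -> F t A -> F t (~` A).
Proof.
move=> /(filF.1 t)[sF _]; rewrite -(sigma_algebra_id sF).
exact: (@measurableC _ (g_sigma_algebraType (F t))).
Qed.

Lemma adapted_open (s t : R) U : 0 <= s -> s <= t -> t <= T -> open U ->
  F t (X s @^-1` U).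
Proof.
move=> s0 st tT oU; apply: (filF.2 s t s0 st tT); apply: adX; first by lra.
exact: sub_sigma_algebra.
Qed.

Lemma adapted_closed_ball (t : R) x (r : R) : 0 <= t <= T ->
  F t (X t @^-1` metric_closed_ball x r).
Proof.
move=> tT; rewrite (_ : _ @^-1` _ = ~` (X t @^-1` [set z | r < mdist x z])).
  apply: filtration_setC => //.
  by apply: adapted_open; [lra..|exact: open_mdist_gt].
by apply/seteqP; split=> w /=; rewrite /metric_closed_ball /= leNgt => /negP.
Qed.

Lemma filtration_exit_event (s eps c t : R) :
  0 <= s -> 0 < eps -> s + eps <= t -> t <= T -> 0 < c ->
  F t (exit_event T X (fun=> s%:E) eps c).
Proof.
move=> s0 eps0 st tT c0; have /(filF.1 t)[sF _] : 0 <= t <= T by lra.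
rewrite -(sigma_algebra_id sF).
(* The ambient sigma-algebra is now [F t], which contains all preimages under [X u] for
   [u <= s + eps <= t]. *)
apply: (@measurable_exit_event_cst _ (g_sigma_algebraType (F t))) => //;
  last by lra.
move=> u uT U oU; rewrite /measurable/= (sigma_algebra_id sF).
by apply: adapted_open => //; lra.
Qed.

Lemma filtration_dyadic_osc (alpha b s h : R) : 0 <= s -> 0 < h -> s + h <= T ->
  0 < b -> F (s + h) (dyadic_osc T X alpha b s h).
Proof.
move=> s0 h0 sT b0; have /(filF.1 _)[sF _] : 0 <= s + h <= T by lra.
rewrite -(sigma_algebra_id sF).
apply: (@bigcupT_measurable _ (g_sigma_algebraType (F (s + h)))) => n.
apply: (@bigcup_measurable _ (g_sigma_algebraType (F (s + h)))) => k /= kn.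
rewrite /measurable/= (sigma_algebra_id sF).
have e0 : 0 < h / 2 ^+ n by rewrite divr_gt0// exprn_gt0.
have kh := dyadic_piece_le h n k h0 kn.
have kh0 : 0 <= k%:R * (h / 2 ^+ n) by rewrite mulr_ge0// ltW.
move: kh; rewrite -addn1 natrD mulrDl mul1r => kh.
by apply: filtration_exit_event => //; [lra..|rewrite mulr_gt0// powR_gt0].
Qed.

Variables (alpha C1 : R).
Hypothesis exit_tail : forall (r eps : R) (tau : Omega -> \bar R),
  0 < r -> 0 < eps -> holder_stopping_time alpha T X tau ->
  {ae P, forall w, (tau w < +oo)%E ->
    cond_prob P (stopped_sigma_algebra T F tau) (exit_event T X tau eps r) w
    <= C1 * expR (- r ^+ 2 / (C1 * eps))}.

(* The time [s] is the Hoelder stopping time [tau_0] started at [s]. *)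
Lemma exit_event_prob_le (s eps r : R) B : 0 <= s -> 0 < eps -> s + eps <= T ->
  0 < r -> F s B ->
  (P (exit_event T X (fun=> s%:E) eps r `&` B)
    <= (C1 * expR (- r ^+ 2 / (C1 * eps)))%:E * P B)%E.
Proof.
move=> s0 eps0 sT r0 FB; have s0T : 0 <= s <= T by lra.
have hs : holder_stopping_time alpha T X (fun=> s%:E).
  by exists 1, 1, s, 0%N; split.
have := exit_tail _ _ _ r0 eps0 hs.
rewrite (stopped_sigma_algebra_cst T F s filF s0T) => tail.
have [sF Fm] := filF.1 s s0T.
apply: (cond_prob_le P (F s)) => //.
  apply: (filtration_measurable (s + eps)); first by lra.
  by apply: filtration_exit_event.
by apply: filterS tail => w; apply; exact: ltry.
Qed.

(** A union bound over intervals of length [e = h / 2 ^+ n]. The exponent in (1) is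
    [b ^+ 2 * e ^ (2 * alpha - 1) / C1], that is, [lam * (2 ^+ n) ^ (1 - 2 * alpha)] with [lam = b
    ^+ 2 / (C1 * h ^ (1 - 2 * alpha))]; so [tail] gives level [n] the share [delta / 2 ^+ n.+1]. *)
Lemma dyadic_osc_prob_le (b s h lam0 delta : R) B :
  0 < C1 -> 0 <= s -> 0 < h -> s + h <= T -> 0 < b -> 0 <= delta ->
  (forall (lam : R) n, lam0 <= lam ->
    2 ^+ n * (C1 * expR (- (lam * (2 ^+ n) `^ (1 - 2 * alpha))))
      <= delta / 2 ^+ n.+1) ->
  lam0 <= b ^+ 2 / (C1 * h `^ (1 - 2 * alpha)) -> F s B ->
  (P (dyadic_osc T X alpha b s h `&` B) <= delta%:E * P B)%E.
Proof.
move=> C10 s0 h0 sT b0 delta0 tail lamb FB.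
have s0T : 0 <= s <= T by lra.
have mB := filtration_measurable s B s0T FB.
pose e n : R := h / 2 ^+ n.
have e0 n : 0 < e n by rewrite /e divr_gt0// exprn_gt0.
have kh n k : (k < 2 ^ n)%N -> [/\ 0 <= s + k%:R * e n, s <= s + k%:R * e n &
    s + k%:R * e n + e n <= s + h].
  move=> kn; have kh0 : 0 <= k%:R * e n by rewrite mulr_ge0// ltW.
  have := dyadic_piece_le h n k h0 kn; rewrite -/(e n).
  by rewrite -addn1 natrD mulrDl mul1r => ?; split; lra.
pose D n k := exit_event T X (fun=> (s + k%:R * e n)%:E) (e n)
  (b * e n `^ alpha) `&` B.
have mD n k : (k < 2 ^ n)%N -> measurable (D n k).
  move=> /kh[k0 ks kT]; apply: measurableI => //.
  apply: (filtration_measurable (s + h)); first by lra.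
  by apply: filtration_exit_event => //; rewrite mulr_gt0// powR_gt0.
rewrite (_ : _ `&` B = \bigcup_n \bigcup_(k < 2 ^ n) D n k); last first.
  rewrite /dyadic_osc setI_bigcupl; apply: eq_bigcupr => n _.
  by rewrite setI_bigcupl.
have mDn n : measurable (\bigcup_(k < 2 ^ n) D n k).
  by apply: bigcup_measurable => k; exact: mD.
have := @measure_sigma_subadditive _ _ _ P _ _ mDn (bigcupT_measurable _ mDn)
  (fun _ => id).
move=> /le_trans; apply.
have PB : P B = (fine (P B))%:E by rewrite fineK// fin_num_measure.
have PB0 : 0 <= fine (P B) by rewrite fine_ge0.
rewrite PB -EFinM.
(* The shares of all levels add up to at most [delta * P B]. *)
apply: le_trans (epsilon_trick0 xpredT (mulr_ge0 delta0 PB0)).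
apply: lee_nneseries => // n _.
rewrite natrX mulrAC.
apply: (le_trans (y := \sum_(k < 2 ^ n) P (D n k))%E).
  rewrite bigcup_mkord.
  by apply: Boole_inequality => k /mD.
apply: (le_trans (y := \sum_(k < 2 ^ n)
    (C1 * expR (- (b * e n `^ alpha) ^+ 2 / (C1 * e n)) * fine (P B))%:E)%E).
  apply: lee_sum => -[k /= kn] _; have [k0 ks kT] := kh n k kn.
  rewrite EFinM -PB; apply: exit_event_prob_le => //; first by lra.
    by rewrite mulr_gt0// powR_gt0.
  (* Since [B] is in [F s], it is also known at the later dyadic time at which (1) is used. *)
  by apply: (filF.2 s) => //; have := e0 n; lra.
rewrite sumEFin sumr_const card_ord lee_fin -[leLHS]mulr_natl natrX mulrA.
rewrite ler_wpM2r//.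
apply: le_trans (tail _ n lamb).
rewrite ler_pM2l ?exprn_gt0// ler_pM2l// ler_expR mulNr lerN2.
have ea : (e n `^ alpha) ^+ 2 * e n `^ (1 - 2 * alpha) = e n.
  rewrite -powR_mulrn ?powR_ge0// -powRrM -powRD ?(gt_eqF (e0 n)) ?implybT//.
  by rewrite mulrC addrC subrK powRr1// ltW.
have he : e n `^ (1 - 2 * alpha) * (2 ^+ n) `^ (1 - 2 * alpha)
    = h `^ (1 - 2 * alpha).
  by rewrite -powRM ?exprn_ge0 ?(ltW (e0 n))// /e divfK// expf_neq0.
rewrite -he exprMn.
rewrite (_ : C1 * e n = C1 * ((e n `^ alpha) ^+ 2 * e n `^ (1 - 2 * alpha))).
  have pn0 := powR_gt0 (1 - 2 * alpha) (e0 n).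
  have an0 := powR_gt0 alpha (e0 n).
  have Q0 : 0 < (2 ^+ n) `^ (1 - 2 * alpha) :> R.
    by rewrite powR_gt0// exprn_gt0.
  rewrite le_eqVlt; apply/orP; left; apply/eqP; field.
  by rewrite !gt_eqF.
by rewrite ea.
Qed.


(** * Return to the ball and iteration over the pieces *)

Variables (c2 C2 : R) (x : E).
Hypothesis return_prob : forall s eps : R, 0 <= s <= T -> 0 < eps <= T - s ->
  {ae P, forall w,
    c2 * \1_(X s @^-1` metric_closed_ball x (C2 * eps `^ (1 / 2))) w
    <= cond_prob P (F s)
      (X (s + eps) @^-1` metric_closed_ball x (C2 * eps `^ (1 / 2))) w}.

Lemma return_prob_ge (s eps : R) B : 0 <= s -> 0 < eps -> s + eps <= T ->
  F s B -> B `<=` X s @^-1` metric_closed_ball x (C2 * eps `^ (1 / 2)) ->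
  (c2%:E * P B <=
    P (X (s + eps) @^-1` metric_closed_ball x (C2 * eps `^ (1 / 2)) `&` B))%E.
Proof.
move=> s0 eps0 sT FB Bball; have s0T : 0 <= s <= T by lra.
rewrite -[in leLHS](setIidr Bball).
have [sF Fm] := filF.1 s s0T.
apply: (cond_prob_ge P (F s)) => //.
- apply: (filtration_measurable (s + eps)); first by lra.
  by apply: adapted_closed_ball; lra.
- by apply: return_prob; lra.
- by apply: Fm; exact: adapted_closed_ball.
Qed.

(** The good event after [k] pieces. The ball at time 0 is not part of it; it enters through the
    event [B] of [localized_prob_ge]. *)
Fixpoint localized (b h : R) (k : nat) : set Omega :=
  if k is m.+1 then
    X (k%:R * h) @^-1` metric_closed_ball x (C2 * h `^ (1 / 2)) `&`
    (~` dyadic_osc T X alpha b (m%:R * h) h `&` localized b h m)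
  else setT.

(** On the good event so far the path is in the ball, so it is there again one piece later with
    conditional probability at least [c2 >= 2 * q]. Removing the bad oscillations, of conditional
    probability at most [q], leaves a factor [q] per piece. *)
Lemma localized_prob_ge (b h q : R) (N : nat) B :
  0 < h -> N%:R * h <= T -> 0 < b -> 0 <= q -> 2 * q <= c2 ->
  (forall s A, 0 <= s -> s + h <= T -> F s A ->
    (P (dyadic_osc T X alpha b s h `&` A) <= q%:E * P A)%E) ->
  F 0 B -> B `<=` X 0 @^-1` metric_closed_ball x (C2 * h `^ (1 / 2)) ->
  F (N%:R * h) (localized b h N `&` B) /\
  ((q ^+ N)%:E * P B <= P (localized b h N `&` B))%E.
Proof.
move=> h0 NT b0 q0 qc2 osc FB Bball.
(* The induction also carries the inclusion in the ball at time [N%:R * h], on which the next return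
   estimate depends. *)
suff : [/\ F (N%:R * h) (localized b h N `&` B),
    localized b h N `&` B `<=`
      X (N%:R * h) @^-1` metric_closed_ball x (C2 * h `^ (1 / 2)) &
    ((q ^+ N)%:E * P B <= P (localized b h N `&` B))%E] by case.
elim: N NT => [|N IH] NT; first by rewrite mul0r setTI expr0 mul1e.
have NE : N.+1%:R * h = N%:R * h + h by rewrite -addn1 natrD mulrDl mul1r.
have N0 : 0 <= N%:R * h by rewrite mulr_ge0// ltW.
have NT' : N%:R * h <= T by lra.
have {IH}[FA Aball PA] := IH NT'.
set A := localized b h N `&` B in FA Aball PA.
set O := dyadic_osc T X alpha b (N%:R * h) h.
set S := X (N.+1%:R * h) @^-1` metric_closed_ball x (C2 * h `^ (1 / 2)).
have AE : localized b h N.+1 `&` B = S `&` (~` O `&` A) by rewrite /= !setIA.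
have NT0 : 0 <= N.+1%:R * h <= T by lra.
have FS : F (N.+1%:R * h) S by exact: adapted_closed_ball.
have FO : F (N.+1%:R * h) O.
  by rewrite NE; apply: filtration_dyadic_osc => //; lra.
have FA' : F (N.+1%:R * h) A by apply: (filF.2 (N%:R * h)) => //; lra.
rewrite AE; split.
- by do 2!(apply: filtration_setI => //); exact: filtration_setC.
- by move=> w [].
have mS := filtration_measurable _ _ NT0 FS.
have mO := filtration_measurable _ _ NT0 FO.
have mA := filtration_measurable _ _ NT0 FA'.
have mB : measurable B by apply: filtration_measurable FB; lra.
have PO : (P (O `&` A) <= q%:E * P A)%E by apply: osc => //; lra.
have PS : (c2%:E * P A <= P (S `&` A))%E.
  by rewrite /S NE; apply: return_prob_ge => //; lra.
have mSOA : measurable (S `&` (~` O `&` A)).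
  by do 2!(apply: measurableI => //); exact: measurableC.
have mOA : measurable (O `&` A) by exact: measurableI.
have PU : (P (S `&` A) <= P (S `&` (~` O `&` A)) + P (O `&` A))%E.
  apply: le_trans (measureU2 P mSOA mOA).
  apply: le_measure; rewrite ?inE; [exact: measurableI|exact: measurableU|].
  move=> w [Sw Aw]; have [Ow|Ow] := pselect (O w); [by right|by left].
have fE U : measurable U -> P U = (fine (P U))%:E.
  by move=> mU; rewrite fineK// fin_num_measure.
move: PA PO PS PU; rewrite (fE A)// (fE B)// (fE _ mSOA) (fE _ mOA).
rewrite (fE (S `&` A)); last exact: measurableI.
rewrite -!EFinM -EFinD !lee_fin => PA PO PS PU.
have PA0 : 0 <= fine (P A) by rewrite fine_ge0.
rewrite exprS -mulrA.
apply: le_trans (_ : q * fine (P A) <= _); first by rewrite ler_wpM2l.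
have := ler_wpM2r PA0 qc2; lra.
Qed.

Lemma localizedP (b h : R) (N : nat) w : localized b h N w ->
  forall k, (k < N)%N -> ~ dyadic_osc T X alpha b (k%:R * h) h w /\
    mdist x (X (k.+1%:R * h) w) <= C2 * h `^ (1 / 2).
Proof.
elim: N => // N IH [XN [ON /IH H]] k.
by rewrite ltnS leq_eqVlt => /orP[/eqP ->|/H].
Qed.

(** The constant [6 * b] on each piece comes from the dyadic bound; gluing through the centre [x]
    triples it. *)
Lemma localized_holder (b h : R) (N : nat) w :
  0 < alpha < 1 -> 0 < h -> 0 < b -> N.+1%:R * h <= T ->
  2 * (C2 * h `^ (1 / 2)) <= 6 * b * h `^ alpha ->
  localized b h N.+1 w ->
  forall u v, 0 <= u -> u < v -> v <= N.+1%:R * h ->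
    mdist (X u w) (X v w) <= 18 * b * `|u - v| `^ alpha.
Proof.
move=> al h0 b0 NT hb /localizedP loc u v u0 uv vN.
rewrite (_ : 18 * b = 3 * (6 * b)); last by lra.
apply: (holder_glue (X^~ w) x alpha h (6 * b) (C2 * h `^ (1 / 2)) N) => //.
- by case/andP: al.
- by lra.
- move=> k u' v' kN ku uv' vk; have [nosc _] := loc k kN.
  apply: (holder_of_not_dyadic_osc T X alpha b (k%:R * h) h w al h0 _ nosc)
    => //.
  apply: le_trans NT; rewrite -[X in _ + X]mul1r -mulrDl ler_pM2r//.
  by rewrite natr1 ler_nat.
- by case=> // k /= kN; case: (loc k (ltnW kN)).
Qed.

End filtered_process.

(** * Choice of the constants and conclusion *)

(** Splitting the exponent 1/2 as [(1 - 2 * alpha) / 2 + alpha] cancels [h ^ alpha]; squaring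
    reduces the claim to [64 * C2 ^+ 2 * h ^ (1 - 2 * alpha) <= gamma ^+ 2]. *)
Lemma radius_le_holder {R : realType} {alpha h K gamma C2 : R} :
  0 < h -> 0 <= gamma -> 0 <= C2 -> K * (64 * C2 ^+ 2) <= 1 ->
  h `^ (1 - 2 * alpha) <= K * gamma ^+ 2 ->
  8 * C2 * h `^ (1 / 2) <= gamma * h `^ alpha.
Proof.
move=> h0 gamma0 C20 K64 hK.
rewrite (_ : 1 / 2 = (1 - 2 * alpha) / 2 + alpha); last by lra.
rewrite powRD ?(gt_eqF h0) ?implybT// mulrA ler_wpM2r ?powR_ge0//.
rewrite -(@ler_pXn2r _ 2) ?nnegrE ?mulr_ge0 ?powR_ge0 ?ler0n//.
rewrite exprMn -[X in _ * X]powR_mulrn ?powR_ge0// -powRrM divfK// exprMn.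
have := ler_wpM2r (exprn_ge0 2 gamma0) K64.
have c64 : 0 <= 64 * C2 ^+ 2 by rewrite mulr_ge0 ?exprn_ge0 ?ler0n.
have := ler_wpM2l c64 hK; lra.
Qed.

(** Here [n] counts the pieces and is at most [2 * T / (kappa * g)], so [q ^+ n = exp (n * ln q)] is
    at least [exp (- C / g)]. *)
Lemma expR_le_pow {R : realType} {q T kappa g C : R} {n : nat} :
  0 < q -> q <= 1 -> 0 < kappa -> 0 < g -> 1 <= C ->
  2 * T * - ln q / kappa <= C -> n%:R * (kappa * g) <= 2 * T ->
  C^-1 * expR (- C / g) <= q ^+ n.
Proof.
move=> q0 q1 kappa0 g0 C1 CT nT.
have nlnq : 0 <= - ln q by rewrite oppr_ge0 ln_le0.
apply: (le_trans (y := expR (- C / g))).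
  by rewrite ler_piMl ?expR_ge0// invf_le1//; lra.
rewrite -[q in leRHS](lnK (x := q)) ?posrE// -expRM_natl ler_expR.
rewrite mulNr lerNl -mulrN ler_pdivlMr//; apply: le_trans CT.
by rewrite ler_pdivlMr//; have := ler_wpM2r nlnq nT; lra.
Qed.

Theorem theorem2p5 (R : realType) (alpha T C1 c2 C2 : R)
    (halpha : 0 < alpha < 1 / 2) (hT : 0 < T)
    (hC1 : 0 < C1) (hc2 : 0 < c2) (hC2 : 0 < C2) :
  exists C c : R, [/\ 0 < C, 0 < c &
    forall (d : measure_display) (Omega : measurableType d)
      (P : probability Omega R) (E : metricType R)
      (F : R -> set_system Omega) (X : R -> Omega -> E) (x : E),
    polish_metric E ->
    is_filtration T F ->
    adapted T F X ->
    continuous_paths T X ->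
    (forall (r eps : R) (tau : Omega -> \bar R), 0 < r -> 0 < eps ->
      holder_stopping_time alpha T X tau ->
      {ae P, forall w, (tau w < +oo)%E ->
        cond_prob P (stopped_sigma_algebra T F tau)
          (exit_event T X tau eps r) w
        <= C1 * expR (- r ^+ 2 / (C1 * eps))}) ->
    (forall s eps : R, 0 <= s <= T -> 0 < eps <= T - s ->
      {ae P, forall w,
        c2 * \1_(X s @^-1` metric_closed_ball x (C2 * eps `^ (1 / 2))) w
        <= cond_prob P (F s)
          (X (s + eps) @^-1` metric_closed_ball x (C2 * eps `^ (1 / 2))) w}) ->
    forall gamma : R, 0 < gamma ->
      {ae P, forall w,
        C^-1 * expR (- C / gamma `^ (2 / (1 - 2 * alpha)))
          * \1_(X 0 @^-1` metric_closed_ball x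
                 (c * gamma `^ (1 / (1 - 2 * alpha)))) w
        <= cond_prob P (F 0)
          [set w' | (holder_norm alpha 0 T (X^~ w') < gamma%:E)%E] w}].
Proof.
pose beta := 1 - 2 * alpha.
have beta0 : 0 < beta by rewrite /beta; lra.
(* [2 * q <= c2] serves the iteration over pieces, [2 * q <= 1] the case of a single piece. *)
pose q := Num.min c2 1 / 2.
have q0 : 0 < q by rewrite divr_gt0// lt_min hc2 ltr01.
have qc2 : 2 * q <= c2 by rewrite mulrC divfK// ge_min lexx.
have q12 : 2 * q <= 1 by rewrite mulrC divfK// ge_min lexx orbT.
have [lam0 lam00 tail] := expR_tail_weighted beta C1 q beta0 hC1 q0.
(* The first term makes the oscillation estimate available for [b = gamma / 24], with 576 the square
   of 24; the second makes the ball small enough for gluing. *)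
pose K := Num.min (576 * C1 * lam0)^-1 (64 * C2 ^+ 2)^-1.
have c576 : 0 < 576 * C1 * lam0 by rewrite mulr_gt0 ?mulr_gt0 ?ltr0n.
have c64 : 0 < 64 * C2 ^+ 2 by rewrite mulr_gt0 ?exprn_gt0 ?ltr0n.
have K0 : 0 < K by rewrite lt_min !invr_gt0 c576 c64.
pose kappa := K `^ beta^-1.
have kappa0 : 0 < kappa by exact: powR_gt0.
(* The 2 gives a prefactor at most 1/2, as the single piece requires; the other term pays for [q] to
   the number of pieces. *)
pose C := Num.max 2 (2 * T * - ln q / kappa).
(* Chosen so that the starting radius equals [C2 * (hg / 2) ^ (1 / 2)], where [hg / 2] will be a
   lower bound for the length of a piece. *)
pose c := C2 * (kappa / 2) `^ (1 / 2).
have C_ge2 : 2 <= C by rewrite le_max lexx.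
have C_ge1 : 1 <= C by lra.
have C0 : 0 < C by lra.
have q1 : q < 1 by lra.
have al0 : 0 < alpha by case/andP: halpha.
have al1 : 0 < alpha < 1 by lra.
have s0T : 0 <= (0 : R) <= T by rewrite lexx ltW.
have T0T : 0 <= T <= T by rewrite lexx ltW.
exists C, c; split=> //; first by rewrite mulr_gt0// powR_gt0 ?divr_gt0.
move=> d Omega P E F X x [_ sepE] filF adX cX exit_tail return_prob.
move=> gamma gamma0.
rewrite -/beta.
set hg := kappa * gamma `^ (2 / beta).
have g0 : 0 < gamma `^ (2 / beta) by exact: powR_gt0.
have hg0 : 0 < hg by rewrite mulr_gt0.
have hgE : hg `^ beta = K * gamma ^+ 2.
  rewrite powRM ?(ltW kappa0) ?(ltW g0)// -!powRrM mulVf ?gt_eqF//.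
  by rewrite divfK ?gt_eqF// powRr1 ?(ltW K0)// powR_mulrn// ltW.
(* Then [18 * b] is three quarters of [gamma], which yields the strict inequality for the norm. *)
pose b := gamma / 24.
have b0 : 0 < b by rewrite divr_gt0.
have hK (h : R) : 0 < h -> h <= hg -> h `^ beta <= K * gamma ^+ 2.
  move=> h0 hh; rewrite -hgE.
  by rewrite ge0_ler_powR ?nnegrE ?(ltW h0) ?(ltW hg0) ?(ltW beta0).
have hlam (h : R) : 0 < h -> h <= hg -> lam0 <= b ^+ 2 / (C1 * h `^ beta).
  move=> h0 /(hK _ h0) hKg.
  rewrite ler_pdivlMr; last by rewrite mulr_gt0// powR_gt0.
  have : K * (576 * C1 * lam0) <= 1.
    by rewrite -ler_pdivlMr// div1r /K ge_min lexx.
  move=> /(ler_wpM2r (exprn_ge0 2 (ltW gamma0))).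
  have := ler_wpM2l (ltW (mulr_gt0 lam00 hC1)) hKg.
  by rewrite /b; lra.
have osc (h s : R) A : 0 < h -> h <= hg -> 0 <= s -> s + h <= T -> F s A ->
    (P (dyadic_osc T X alpha b s h `&` A) <= q%:E * P A)%E.
  move=> h0 hh s0 sT FA.
  apply: (dyadic_osc_prob_le P T F X sepE filF adX cX alpha C1 exit_tail
    b s h lam0 q) => //.
    exact: ltW.
  exact: hlam.
set N := [set w' | _].
have mN : measurable N.
  apply: measurable_holder_norm_lt => //.
  move=> t tT U oU; apply: (filtration_measurable T F filF t) => //.
  by case/andP: tT => t0 tT; exact: (adapted_open T F X filF adX).
have NE w : (forall u v : R, 0 <= u -> u < v -> v <= T ->
    mdist (X u w) (X v w) <= 18 * b * `|u - v| `^ alpha) -> N w.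
  move=> /holder_norm_leP/le_lt_trans; apply; rewrite lte_fin /b.
  by clear -gamma0; lra.
have [sF Fm] := filF.1 0 s0T.
set S := X 0 @^-1` _.
have FS : F 0 S by exact: (adapted_closed_ball T F X filF adX).
apply: ae_cond_prob_ge => // B FB.
set k := C^-1 * _.
have FSB : F 0 (S `&` B) by exact: (filtration_setI T F filF).
have mSB := Fm _ FSB; have mB := Fm _ FB.
have k12 : k <= 2^-1.
  rewrite /k -[leRHS]mulr1.
  apply: ler_pM; rewrite ?expR_ge0 ?invr_ge0 ?(ltW C0)//.
    by rewrite lef_pV2 ?posrE.
  by rewrite expR_le1 mulNr oppr_le0 divr_ge0 ?(ltW g0) ?(ltW C0).
have fE U : measurable U -> P U = (fine (P U))%:E.
  by move=> mU; rewrite fineK// fin_num_measure.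
(* If [T <= hg], the whole interval is one piece, and [P (N & B) >= (1 - q) * P B >= P B / 2]. *)
have [Thg|hgT] := leP T hg.
  set O := dyadic_osc T X alpha b 0 T.
  have OB : (P (O `&` B) <= q%:E * P B)%E by apply: osc => //; rewrite add0r.
  have mO : measurable O.
    apply: (filtration_measurable T F filF (0 + T)); first by rewrite add0r.
    by apply: filtration_dyadic_osc => //; rewrite add0r.
  have mOB : measurable (O `&` B) by exact: measurableI.
  have mNB : measurable (N `&` B) by exact: measurableI.
  have PB : (P B <= P (N `&` B) + P (O `&` B))%E.
    apply: le_trans (measureU2 P mNB mOB).
    apply: le_measure; rewrite ?inE//; first exact: measurableU.
    move=> w Bw; have [Ow|nOw] := pselect (O w); [by right|left; split=> //].
    apply: NE => u v u0 uv vT.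
    apply: (le_trans (y := 6 * b * `|u - v| `^ alpha)).
      apply: (holder_of_not_dyadic_osc T X alpha b 0 T w al1 hT _ nOw) => //.
        by rewrite add0r.
      by rewrite add0r.
    by rewrite ler_wpM2r ?powR_ge0// ler_wpM2r ?(ltW b0)// ler_nat.
  have PSB : (P (S `&` B) <= P B)%E.
    by apply: le_measure; rewrite ?inE//; exact: subIsetr.
  move: OB PB PSB; rewrite (fE B)// (fE _ mSB) (fE _ mOB) (fE _ mNB).
  rewrite -!EFinM -EFinD !lee_fin => OB PB PSB.
  have PSB0 : 0 <= fine (P (S `&` B)) by rewrite fine_ge0.
  have PB0 : 0 <= fine (P B) by rewrite fine_ge0.
  have := ler_wpM2r PSB0 k12; have := ler_wpM2r PB0 q12.
  by clear -OB PB PSB; lra.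
(* With [n >= 1] the integer part of [T / hg], cutting into [n + 1] equal pieces gives a length
   between [hg / 2] and [hg], because [n + 1 <= 2 * n]. *)
pose n := Num.trunc (T / hg).
have /truncn_itv/andP[nT Tn] : 0 <= T / hg.
  by rewrite divr_ge0 ?(ltW hT) ?(ltW hg0).
have n1 : (1 <= n)%N.
  by rewrite -ltnS -(ltr_nat R) (le_lt_trans _ Tn)// ler_pdivlMr// mul1r ltW.
rewrite -/n in nT Tn.
pose h := T / n.+1%:R.
have h0 : 0 < h by rewrite divr_gt0.
have nh : n.+1%:R * h = T by rewrite mulrC divfK.
have hhg : h <= hg.
  by rewrite ler_pdivrMr// mulrC -ler_pdivrMr// ltW.
have hgh : hg / 2 <= h.
  rewrite -(ler_pM2l (x := n.+1%:R))// nh.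
  have : n.+1%:R <= 2 * n%:R :> R.
    by rewrite -natrM ler_nat mul2n -addnn -addn1 leq_add2l.
  move=> /(ler_wpM2r (ltW hg0)).
  by move: nT; rewrite ler_pdivlMr//; clear => ? ?; lra.
have Sball : S `<=` X 0 @^-1` metric_closed_ball x (C2 * h `^ (1 / 2)).
  move=> w; rewrite /S /metric_closed_ball /= => /le_trans; apply.
  rewrite /c -mulrA ler_pM2l//.
  rewrite (_ : 1 / beta = 2 / beta * (1 / 2)); last by clear; lra.
  rewrite (powRrM gamma (2 / beta)) -powRM ?(ltW g0) ?divr_ge0 ?(ltW kappa0)//.
  rewrite (_ : kappa / 2 * _ = hg / 2); last by rewrite mulrAC.
  by rewrite ge0_ler_powR ?nnegrE ?(ltW h0) ?divr_ge0 ?(ltW hg0).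
have hb : 2 * (C2 * h `^ (1 / 2)) <= 6 * b * h `^ alpha.
  have K64 : K * (64 * C2 ^+ 2) <= 1.
    by rewrite -ler_pdivlMr// div1r /K ge_min lexx orbT.
  have := radius_le_holder h0 (ltW gamma0) (ltW hC2) K64 (hK h h0 hhg).
  clear; rewrite /b => ?; lra.
have [] := localized_prob_ge P T F X sepE filF adX cX alpha c2 C2 x return_prob
    b h q n.+1 (S `&` B) h0 _ b0 (ltW q0) qc2 _ FSB _.
- by rewrite nh.
- by move=> s A s0 sT; apply: osc.
- exact: subset_trans Sball.
rewrite nh => FL PL.
(* The number of pieces satisfies [(n + 1) * hg <= 2 * T], since each has length at least
   [hg / 2]. *)
have kq : k <= q ^+ n.+1.
  have CT : 2 * T * - ln q / kappa <= C by rewrite le_max lexx orbT.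
  apply: (expR_le_pow q0 _ kappa0 g0 C_ge1 CT); first exact: ltW.
  rewrite -/hg -nh [leRHS]mulrCA ler_pM2l//.
  by rewrite mulrC -ler_pdivrMr.
apply: (le_trans (y := ((q ^+ n.+1)%:E * P (S `&` B))%E)).
  by rewrite lee_wpmul2r// lee_fin.
apply: (le_trans PL); apply: le_measure; rewrite ?inE.
- exact: (filtration_measurable T F filF T _ T0T FL).
- exact: measurableI.
move=> w [Lw [_ Bw]]; split=> //; apply: NE => u v u0 uv vT.
by apply: (localized_holder T X alpha C2 x b h n w) => //; rewrite nh.
Qed.
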